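(* Let $f:\mathbb{F}_2^n\to\{-1,1\}$ be a Boolean function with Fourier sparsity $k>4$. Then for every $\alpha\in\mathcal{S}$ there exists $\beta\in\mathcal{S}\setminus\{\alpha\}$ such that $|O_{\alpha+\beta}|\ge3$.
   Context: For $\alpha\in\mathbb{F}_2^n$ let $\chi_\alpha(x)=(-1)^{\sum_i\alpha_ix_i}$; every $f:\mathbb{F}_2^n\to\mathbb{R}$ is uniquely $f=\sum_\alpha\widehat f(\alpha)\chi_\alpha$. The Fourier support is $\mathcal{S}=\{\alpha:\widehat f(\alpha)\ne0\}$ and $k=|\mathcal{S}|$. For $\gamma\in\mathbb{F}_2^n$, $O_\gamma$ is the set of unordered pairs $\{\alpha_1,\alpha_2\}$ of distinct elements of $\mathcal{S}$ with $\alpha_1+\alpha_2=\gamma$ (addition in $\mathbb{F}_2^n$). *)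

(* Defs.v *)
From HB Require Import structures.
From mathcomp Require Import all_boot all_order all_algebra.
From mathcomp Require Import reals.

Set Implicit Arguments.
Unset Strict Implicit.
Unset Printing Implicit Defensive.

Import Order.TTheory GRing.Theory Num.Theory.
Local Open Scope ring_scope.

(* The exponent is computed in 'F_2 and then read as 0 or 1. *)
Definition chi (R : realType) (n : nat) (a x : 'rV['F_2]_n) : R :=
  (-1) ^+ (\sum_i a 0 i * x 0 i : 'F_2)%R.

(* The coefficients of f in the basis of characters: fourier_expansion and
   fourier_unique below say that these are the only c with
   f = \sum_a c a * chi a. *)
Definition fourier (R : realType) (n : nat) (f : 'rV['F_2]_n -> R)
    (a : 'rV['F_2]_n) : R :=
  (\sum_x f x * chi R a x) / 2 ^+ n.

Definition fsupp (R : realType) (n : nat) (f : 'rV['F_2]_n -> R) :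
    {set 'rV['F_2]_n} :=
  [set a | fourier f a != 0].

(* An unordered pair of distinct elements is encoded as a two-element set. *)
Definition pairs_of_sum (R : realType) (n : nat) (f : 'rV['F_2]_n -> R)
    (c : 'rV['F_2]_n) : {set {set 'rV['F_2]_n}} :=
  [set [set a1; a2] | a1 in fsupp f, a2 in fsupp f
                    & (a1 != a2) && (a1 + a2 == c)].

Lemma sign_F2D (R : realType) (u v : 'F_2) :
  (-1) ^+ (u + v : 'F_2)%R = (-1) ^+ u * (-1) ^+ v :> R.
Proof.
by case: u v => [[|[|u]] hu] [[|[|v]] hv] //=;
   rewrite ?expr0 ?expr1 ?mulr1 ?mul1r ?mulN1r ?opprK.
Qed.

Lemma chiC (R : realType) (n : nat) (a x : 'rV['F_2]_n) :
  chi R a x = chi R x a.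
Proof. by rewrite /chi; under eq_bigr do rewrite mulrC. Qed.

Lemma chiDr (R : realType) (n : nat) (a x y : 'rV['F_2]_n) :
  chi R a (x + y) = chi R a x * chi R a y.
Proof.
rewrite /chi -sign_F2D -big_split /=; congr (_ ^+ nat_of_ord _).
by apply: eq_bigr => i _; rewrite mxE mulrDr.
Qed.

Lemma chiDl (R : realType) (n : nat) (a b x : 'rV['F_2]_n) :
  chi R (a + b) x = chi R a x * chi R b x.
Proof. by rewrite chiC chiDr !(chiC R x). Qed.

Lemma addrr_F2 (n : nat) (a : 'rV['F_2]_n) : a + a = 0.
Proof.
apply/rowP => i; rewrite !mxE.
by case: (a 0 i) => [[|[|u]] hu] //; apply: val_inj.
Qed.

Lemma sum_chi (R : realType) (n : nat) (c : 'rV['F_2]_n) :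
  \sum_x chi R c x = if c == 0 then 2 ^+ n else 0.
Proof.
case: eqP => [->|/eqP c_neq0].
  rewrite (eq_bigr (fun=> 1)); last first.
    by move=> x _; rewrite /chi big1 // => i _; rewrite mxE mul0r.
  by rewrite sumr_const card_mx card_Fp // mul1n natrX.
have [i ci] : exists i, c 0 i != 0.
  apply/existsP; apply: contraNT c_neq0; rewrite negb_exists => /forallP h.
  by apply/eqP/rowP => i; rewrite mxE; apply/eqP; move: (h i); rewrite negbK.
have ce : chi R c (delta_mx 0 i) = -1.
  have -> : chi R c (delta_mx 0 i) = (-1) ^+ (c 0 i).
    congr (_ ^+ nat_of_ord _); rewrite (bigD1 i) // big1 => [|j /negPf ji].
      by apply: etrans (addr0 _) _; rewrite mxE !eqxx mulr1.
    by rewrite mxE ji andbF mulr0.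
  by case: (c 0 i) ci => [[|[|u]] hu] //; rewrite expr1.
have h : \sum_x chi R c x = - \sum_x chi R c x.
  rewrite {1}(reindex_inj (addIr (delta_mx 0 i))) /=.
  under eq_bigr do rewrite chiDr ce mulrN1.
  by rewrite sumrN.
by move/eqP: h; rewrite -addr_eq0 -mulr2n mulrn_eq0 /= => /eqP.
Qed.

Lemma chi_orthogonal (R : realType) (n : nat) (a b : 'rV['F_2]_n) :
  \sum_x chi R a x * chi R b x = if a == b then 2 ^+ n else 0.
Proof.
under eq_bigr do rewrite -chiDl.
rewrite sum_chi; congr (if _ then _ else _).
by rewrite -[RHS](inj_eq (addIr b)) addrr_F2.
Qed.

Lemma fourier_expansion (R : realType) (n : nat) (f : 'rV['F_2]_n -> R) x :
  f x = \sum_a fourier f a * chi R a x.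
Proof.
have n2 : 2 ^+ n != 0 :> R by rewrite expf_neq0 // pnatr_eq0.
apply: (mulIf n2); rewrite mulr_suml.
transitivity (\sum_a \sum_y f y * (chi R y a * chi R x a)).
  rewrite exchange_big /= (bigD1 x) //= [X in _ + X]big1 => [|y /negPf yx].
    by rewrite -mulr_sumr chi_orthogonal eqxx addr0.
  by rewrite -mulr_sumr chi_orthogonal yx mulr0.
apply: eq_bigr => a _.
rewrite mulrAC /fourier divfK // mulr_suml.
by apply: eq_bigr => y _; rewrite mulrA !(chiC R a).
Qed.

Lemma fourier_unique (R : realType) (n : nat) (f c : 'rV['F_2]_n -> R) :
  (forall x, f x = \sum_a c a * chi R a x) -> forall a, c a = fourier f a.
Proof.
have n2 : 2 ^+ n != 0 :> R by rewrite expf_neq0 // pnatr_eq0.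
move=> fE a; apply: (mulIf n2); rewrite /fourier divfK //.
under eq_bigr do rewrite fE mulr_suml.
rewrite exchange_big /= (bigD1 a) //= [X in _ + X]big1 => [|b /negPf ba].
  under eq_bigr do rewrite -mulrA.
  by rewrite -mulr_sumr chi_orthogonal eqxx addr0.
under eq_bigr do rewrite -mulrA.
by rewrite -mulr_sumr chi_orthogonal ba mulr0.
Qed.

(* Main.v *)
Require Import Defs.
From HB Require Import structures.
From mathcomp Require Import all_boot all_order all_algebra.
From mathcomp Require Import reals.
From mathcomp Require Import zify ring lra.

(* Let c be the Fourier transform of f, S its support, and suppose that
   |O_(a+b)| <= 2 for all b in S \ {a}. Since f^2 = 1, the autocorrelation
   sum_h c(h) c(h + a + b) vanishes, so |O_(a+b)| = 2: the set
   {h in S | h + a + b in S} is a quadruple {a, b, g, d}, and it is the same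
   quadruple for g and d in place of b. The three vanishing autocorrelations
   force e := c / c(a) to take values +1 and -1 on S, with
   e(b) + e(g) + e(d) equal to 1 or -3.
   Put u := sum_S e = f(0) / c(a) and k := |S|. Summing over b the sums over
   {b, g, d} counts each e(h) three times, so 3 (u - 1) = k - 1 mod 4, while
   Parseval gives u^2 = k. As 2^n c(a) is an integer, u divides 2^n; thus u is
   a power of 2 up to sign and u^2 > 4 yields 4 | u, whence 0 = 2 mod 4. *)

Set Implicit Arguments.
Unset Strict Implicit.
Unset Printing Implicit Defensive.

Import Order.TTheory GRing.Theory Num.Theory.
Local Open Scope ring_scope.

Lemma addrK_F2 (n : nat) (a b : 'rV['F_2]_n) : a + b + b = a.
Proof. by rewrite -addrA addrr_F2 addr0. Qed.

Lemma chi0r (R : realType) (n : nat) (a : 'rV['F_2]_n) : chi R a 0 = 1.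
Proof. by rewrite /chi big1 // => i _; rewrite mxE mulr0. Qed.

(** The square of [f] is the constant 1. Multiplying the expansion of [f] by itself gives the
    autocorrelation as its coefficients, so [fourier_unique] identifies them with those of [one]. *)
Lemma fourier_convolution (R : realType) (n : nat) (f : 'rV['F_2]_n -> R) g :
  (forall x, f x = -1 \/ f x = 1) ->
  \sum_a fourier f a * fourier f (a + g) = (g == 0)%:R.
Proof.
move=> hf; pose one (x : 'rV['F_2]_n) : R := 1.
have -> : (g == 0)%:R = fourier one g.
  apply: (fourier_unique (c := fun b => (b == 0)%:R)) => x.
  rewrite (bigD1 0) //= big1 => [|b /negPf ->]; last by rewrite mul0r.
  by rewrite eqxx mul1r addr0 chiC chi0r.
pose c b : R := \sum_a fourier f a * fourier f (a + b).
apply: (fourier_unique (c := c)) => x.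
transitivity (f x * f x); first by rewrite /one; case: (hf x) => ->; ring.
rewrite {1}(fourier_expansion f) mulr_suml /c.
under [RHS]eq_bigr do rewrite mulr_suml.
rewrite exchange_big /=; apply: eq_bigr => a _.
rewrite (fourier_expansion f) mulr_sumr (reindex_inj (addrI a)) /=.
apply: eq_bigr => b _; rewrite chiDl.
have chi2 : chi R a x * chi R a x = 1.
  by rewrite -chiDl addrr_F2 chiC chi0r.
by rewrite -[RHS]mulr1 -chi2; ring.
Qed.

Definition shift_inter (n : nat) (S : {set 'rV['F_2]_n}) g :=
  [set h in S | h + g \in S].

Lemma in_shift_inter (n : nat) (S : {set 'rV['F_2]_n}) g h :
  (h \in shift_inter S g) = (h \in S) && (h + g \in S).
Proof. by rewrite inE. Qed.

(** Each [h] of the set lies in the pair formed by [h] and [h + g], so the pairs, of two elements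
    each, cover it. *)
Lemma card_shift_inter (R : realType) (n : nat) (f : 'rV['F_2]_n -> R) g :
  g != 0 -> (#|shift_inter (fsupp f) g| <= (#|pairs_of_sum f g|).*2)%N.
Proof.
move=> g0; apply: leq_trans (_ : #|cover (pairs_of_sum f g)| <= _)%N.
  apply/subset_leq_card/subsetP => h; rewrite inE => /andP[hS hgS].
  apply/bigcupP; exists [set h; h + g]; last by rewrite !inE eqxx.
  apply/imset2P; exists h (h + g) => //; rewrite inE hgS /=.
  by rewrite addrA addrr_F2 add0r eqxx andbT -subr_eq0 opprD addrA subrr add0r oppr_eq0.
apply: leq_trans (leq_card_cover _) _.
rewrite -muln2 -sum_nat_const; apply: leq_sum => A /imset2P[x y _ _ ->].
by rewrite cards2; case: (_ == _).
Qed.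

Lemma shift_inter_quad (R : realType) (n : nat) (f : 'rV['F_2]_n -> R) a b
    (S := fsupp f) :
  (forall x, f x = -1 \/ f x = 1) -> a \in S -> b \in S -> b != a ->
  (forall b, b \in S -> b != a -> #|shift_inter S (a + b)| <= 4)%N ->
  exists g d, [/\ uniq [:: a; b; g; d],
    shift_inter S (a + b) = [set:: [:: a; b; g; d]]
    & [/\ fourier f a * fourier f b = - (fourier f g * fourier f d),
     fourier f a * fourier f g = - (fourier f b * fourier f d)
    & fourier f a * fourier f d = - (fourier f b * fourier f g)]].
Proof.
move=> hf aS bS ba hQ; set c := fourier f.
have cS x : (x \in S) = (c x != 0) by rewrite inE.
have ab0 x : x != a -> (a + x == 0) = false.
  move=> xa; apply: contraNF xa => /eqP h.
  by rewrite -[x](addrK_F2 _ a) [x + a]addrC h add0r.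
have conv x : x != a -> \sum_(h in shift_inter S (a + x)) c h * c (h + (a + x)) = 0.
  move=> xa; have := fourier_convolution (a + x) hf; rewrite ab0 // => h; rewrite -[RHS]h {h}.
  rewrite [RHS](bigID (mem (shift_inter S (a + x)))) /= [X in _ = _ + X]big1 ?addr0 //.
  move=> h; rewrite in_shift_inter !cS negb_and !negbK.
  by case/orP => /eqP; rewrite -/c => ->; rewrite ?mul0r ?mulr0.
have aab (x : 'rV['F_2]_n) : a + (a + x) = x by rewrite addrA addrr_F2 add0r.
have bab (x y : 'rV['F_2]_n) : x + (y + x) = y by rewrite addrC addrK_F2.
(* The labels stay free because [a + b + g + d = 0]: pairing [a] with [b], [g] or [d] gives the same
   quadruple, and this step serves all three pairings. *)
have quad x y z : uniq [:: a; x; y; z] -> x \in S -> y \in S -> z \in S ->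
    y + (a + x) = z ->
    shift_inter S (a + x) = [set:: [:: a; x; y; z]] /\ c a * c x = - (c y * c z).
  move=> U xS yS zS yz; have xa : x != a.
    by move: U; rewrite /= inE negb_or eq_sym => /andP[/andP[]].
  have zy : z + (a + x) = y by rewrite -yz addrK_F2.
  have E : shift_inter S (a + x) = [set:: [:: a; x; y; z]].
    apply/esym/eqP; rewrite eqEcard; apply/andP; split.
      apply/subsetP => h; rewrite in_set !in_cons in_nil orbF in_shift_inter.
      by case/or4P => /eqP ->; rewrite ?aab ?bab ?yz ?zy; apply/andP; split.
    by apply: leq_trans (hQ x xS xa) _; rewrite cardsE (card_uniqP U).
  split=> //; have := conv x xa; rewrite E.
  rewrite (eq_bigl (mem [:: a; x; y; z])); last by move=> h; rewrite inE.
  rewrite -big_uniq //= !big_cons big_nil aab bab yz zy; lra.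
(* Were [a] and [b] alone, the vanishing autocorrelation would read [2 * c a * c b = 0], although
   both coefficients are nonzero. *)
have [g] : exists g, g \in shift_inter S (a + b) :\: [set a; b].
  apply/set0Pn; apply/eqP => Q0.
  have E : shift_inter S (a + b) = [set:: [:: a; b]].
    apply/setP => h; rewrite [in RHS]in_set !in_cons in_nil orbF.
    apply/idP/idP => [H|].
      by move/setP/(_ h): Q0; rewrite in_setD H in_set2 in_set0 andbT => /negbFE.
    by case/orP => /eqP ->; rewrite in_shift_inter ?aab ?bab aS bS.
  have := conv b ba; rewrite E.
  rewrite (eq_bigl (mem [:: a; b])); last by move=> h; rewrite inE.
  rewrite -big_uniq; last by rewrite /= inE eq_sym ba.
  rewrite !big_cons big_nil aab bab /= => h.
  have /eqP : c a * c b = 0 by lra.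
  by rewrite mulf_eq0 -[_ || _]negbK negb_or -!cS aS bS.
rewrite in_setD in_set2 negb_or in_shift_inter.
move=> /andP[/andP[ga gb] /andP[gS dS]].
set d := g + (a + b) in dS.
have U : uniq [:: a; b; g; d].
  have da : d != a.
    apply: contraNneq gb => h; have := addrK_F2 g (a + b).
    by rewrite -/d h aab => ->.
  have db : d != b.
    apply: contraNneq ga => h; have := addrK_F2 g (a + b).
    by rewrite -/d h bab => ->.
  have dg : d != g.
    apply: contraFneq (ab0 b ba) => h; have := congr1 (+%R g) h.
    by rewrite /d addrr_F2 addrA addrr_F2 add0r => ->.
  rewrite /= !inE !negb_or !(eq_sym a) (eq_sym b g) (eq_sym b d) (eq_sym g d).
  by rewrite ba ga da gb db dg.
exists g, d; have [E1 e1] := quad b g d U bS gS dS erefl.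
have [||_ e2] := quad g b d _ gS bS dS _.
- by rewrite (perm_uniq (s2 := [:: a; b; g; d])) //; apply/permP => p /=; lia.
- by rewrite /d addrA [b + a]addrC [RHS]addrC.
have [||_ e3] := quad d b g _ dS bS gS _.
- by rewrite (perm_uniq (s2 := [:: a; b; g; d])) //; apply/permP => p /=; lia.
- by rewrite /d addrA [g + _]addrC addrA [b + a]addrC addrr_F2 add0r.
by split.
Qed.

(** After division by [a], each of the three ratios is minus the product of the other two.
    Substituting one relation into another shows that the ratios square to 1. With signs [s] and
    [t], the sum [s + t - s * t] is -3 if [s = t = -1] and 1 otherwise. The values are written
    [1 - m] to fit [sum_two_values]. *)
Lemma quad_signs (F : fieldType) (a b g d : F) :
  a != 0 -> b != 0 -> g != 0 -> d != 0 ->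
  a * b = - (g * d) -> a * g = - (b * d) -> a * d = - (b * g) ->
  (b / a = 1 \/ b / a = 1 - 2) /\
  (b / a + g / a + d / a = 1 \/ b / a + g / a + d / a = 1 - 4).
Proof.
move=> a0 b0 g0 d0 e1 e2 e3.
have div_sign x y z : a * z = - (x * y) -> z / a = - (x / a * (y / a)).
  move=> h; have -> : z = - (x * y) / a by rewrite -h mulrC mulKf.
  by field.
have sqr1 x y z : z != 0 -> a * y = - (x * z) -> a * z = - (x * y) ->
    x / a = 1 \/ x / a = -1.
  move=> z0 hy hz; have /eqP : (x / a) ^+ 2 = 1.
    have za0 : z / a != 0 by rewrite mulf_neq0 ?invr_neq0.
    apply: (mulIf za0); rewrite mul1r {2}(div_sign _ _ _ hz) (div_sign _ _ _ hy).
    ring.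
  by rewrite sqrf_eq1 => /orP[] /eqP; [left | right].
rewrite (div_sign _ _ _ e3).
have e3' : a * d = - (g * b) by rewrite e3 mulrC.
by have [->|->] := sqr1 b g d d0 e2 e3; have [->|->] := sqr1 g b d d0 e1 e3';
  split; solve [left; ring | right; ring].
Qed.

(** The witness [j] counts the indices assigned the value [1 - m]. This makes a sum in [R] an
    integer with known residue modulo [m]. *)
Lemma sum_two_values (R : comPzRingType) (I : finType) (A : {pred I})
    (F : I -> R) (m : R) :
  (forall i, i \in A -> F i = 1 \/ F i = 1 - m) ->
  exists j : nat, \sum_(i in A) F i = #|A|%:R - m * j%:R.
Proof.
move=> hF; have hb i : exists t : bool, i \in A -> F i = 1 - m * t%:R.
  have [iA|_] := boolP (i \in A); last by exists false.
  by case: (hF i iA) => ->; [exists false | exists true] => _; rewrite ?mulr1 ?mulr0 ?subr0.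
have [t ht] := fin_all_exists hb.
exists (\sum_(i in A) t i)%N.
rewrite (eq_bigr _ ht) sumrB sumr_const -mulr_sumr natr_sum.
by [].
Qed.

Lemma no_integer_solution (n k j : nat) (u v : int) : (4 < k)%N ->
  u ^+ 2 = k%:Z -> 3 * (u - 1) = k%:Z - 1 - 4 * j%:Z -> absz (u * v) = (2 ^ n)%N ->
  False.
Proof.
move=> k4 u2 huk huv.
have : (absz u %| 2 ^ n)%N by rewrite -huv abszM dvdn_mulr.
case/(dvdn_pfactor _ _ (isT : prime 2)) => e _ ue.
have uu : (absz u ^ 2 = k)%N by apply/eqP; rewrite -eqz_nat -abszX u2.
(* The exponents 0 and 1 would give [k = 1] and [k = 4]. *)
case: e ue => [|[|e]] ue; try by move: k4; rewrite -uu ue.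
have ue4 : (absz u = 4 * 2 ^ e)%N by rewrite ue !expnS mulnA.
(* Modulo 4 the two sides of [huk] are now -3 and -1. *)
move: uu; rewrite ue4; lia.
Qed.

Theorem theorem3 (R : realType) (n : nat) (f : 'rV['F_2]_n -> R)
    (hf : forall x, f x = -1 \/ f x = 1)
    (hk : (4 < #|fsupp f|)%N) :
  forall alpha, alpha \in fsupp f ->
  exists beta, beta \in fsupp f :\ alpha /\
    (3 <= #|pairs_of_sum f (alpha + beta)|)%N.
Proof.
move=> a aS; set S := fsupp f in hk aS *; pose c := fourier f.
have cS x : (x \in S) = (c x != 0) by rewrite inE.
have [/existsP[b /andP[bS hb]]|noB] :=
  boolP [exists b, (b \in S :\ a) && (3 <= #|pairs_of_sum f (a + b)|)%N].
  by exists b.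
exfalso.
have hQ b : b \in S -> b != a -> (#|shift_inter S (a + b)| <= 4)%N.
  move=> bS ba; apply: leq_trans (card_shift_inter _ _) _.
    by apply: contraNneq ba => h; rewrite -[b](addrK_F2 _ a) [b + a]addrC h add0r.
  rewrite (leq_double _ 2) leqNgt; apply: contra noB => h.
  by apply/existsP; exists b; rewrite in_setD1 ba bS.
pose e x := c x / c a.
have a0 : c a != 0 by rewrite -cS.
have signs b : b \in S :\ a ->
    (e b = 1 \/ e b = 1 - 2) /\
    (#|shift_inter S (a + b) :\ a| = 3 /\
    (\sum_(h in shift_inter S (a + b) :\ a) e h = 1 \/
     \sum_(h in shift_inter S (a + b) :\ a) e h = 1 - 4)).
  rewrite in_setD1 => /andP[ba bS].
  have [g [d [U E [e1 e2 e3]]]] := shift_inter_quad hf aS bS ba hQ.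
  have QS x : x \in [:: a; b; g; d] -> c x != 0.
    move=> xQ; rewrite -cS; have : x \in shift_inter S (a + b) by rewrite E in_set.
    by rewrite in_shift_inter => /andP[].
  have Q' : shift_inter S (a + b) :\ a =i [:: b; g; d].
    move=> x; rewrite E in_setD1 in_set in_cons.
    by case: eqP => [->|//]; move: U => /= /andP[/negPf ->].
  have U' : uniq [:: b; g; d] by case/andP: U.
  have [|||s1 s2] := quad_signs a0 _ _ _ e1 e2 e3; rewrite ?QS ?inE ?eqxx ?orbT //.
  split=> //; split; first by rewrite (eq_card Q') (card_uniqP U').
  by rewrite (eq_bigl _ _ Q') -big_uniq //= !big_cons big_nil addr0 addrA.
pose u := \sum_(b in S) e b.
have uE : u = 1 + \sum_(b in S :\ a) e b.
  by rewrite /u (big_setD1 a) //= {1}/e divff.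
have [j hj] : exists j : nat, 3 * (u - 1) = #|S :\ a|%:R - 4 * j%:R.
  have [j jE] := sum_two_values (fun b hb => (signs b hb).2.2).
  exists j.
  (* Double counting: [h] lies in the triple of [b] exactly when [b] lies in the triple of [h], so
     each [e h] occurs as often as that triple has elements, three times. *)
  rewrite -[RHS]jE (exchange_big_dep (mem (S :\ a))) /=; last first.
    by move=> b h _; rewrite !in_setD1 in_shift_inter => /and3P[-> ->].
  rewrite uE [1 + _]addrC addrK mulr_sumr; apply: eq_bigr => h hS.
  rewrite (eq_bigl (mem (shift_inter S (a + h) :\ a))) => [|b].
    by rewrite sumr_const (signs h hS).2.1 mulr_natl.
  move: hS; rewrite !in_setD1 !in_shift_inter => /andP[-> ->] /=.
  rewrite [RHS]in_setD1 in_shift_inter -andbA.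
  by rewrite [h + _]addrC -addrA [b + (a + h)]addrCA.
have [q hq] : exists q : nat, u = #|S|%:R - 2 * q%:R.
  apply: sum_two_values => b bS; have [->|ba] := eqVneq b a.
    by left; rewrite /e divff.
  by apply: (signs b _).1; rewrite in_setD1 ba.
have sumS (F : _ -> R) :
    (forall x, c x = 0 -> F x = 0) -> \sum_x F x = \sum_(x in S) F x.
  move=> F0; rewrite [RHS]big_mkcond; apply: eq_bigr => x _; rewrite cS.
  by case: eqP => // /F0.
have f0 : f 0 = u * c a.
  rewrite fourier_expansion sumS => [|x]; last by rewrite -/c => ->; rewrite mul0r.
  rewrite mulr_suml; apply: eq_bigr => x _.
  by rewrite chi0r mulr1 divfK.
(* This is the autocorrelation at 0, all squared coefficients on [S] being equal to [c a ^+ 2]. *)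
have parseval : #|S|%:R * c a ^+ 2 = 1.
  have := fourier_convolution 0 hf; rewrite eqxx => conv; rewrite -[RHS]conv {conv}.
  rewrite sumS => [|x]; last by rewrite -/c => ->; rewrite mul0r.
  rewrite mulr_natl -sumr_const; apply: eq_bigr => x xS; rewrite addr0 -expr2 -/c.
  have [->//|xa] := eqVneq x a.
  have : e x ^+ 2 = 1.
    have [|[->|->] _] := signs x; first by rewrite in_setD1 xa.
      by rewrite expr1n.
    ring.
  by rewrite /e expr_div_n => /(canRL (divfK _)) ->; rewrite ?mul1r ?expf_neq0.
have f2 : f 0 ^+ 2 = 1 by case: (hf 0) => ->; ring.
have u2 : u ^+ 2 = #|S|%:R.
  have ca2 : c a ^+ 2 != 0 by rewrite expf_neq0.
  by apply: (mulIf ca2); rewrite parseval -exprMn -f0.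
(* The unnormalised coefficient is a sum of signs, hence an integer. *)
have [p hp] : exists p : nat,
    \sum_x f x * chi R a x = #|'rV['F_2]_n|%:R - 2 * p%:R.
  apply: sum_two_values => x _.
  rewrite /chi -signr_odd.
  case: (hf x) => ->; case: (odd _); rewrite ?expr0 ?expr1;
    by [left; ring | right; ring].
pose v : int := #|'rV['F_2]_n|%:Z - 2 * p%:Z.
have n2 : 2 ^+ n != 0 :> R by rewrite expf_neq0 // pnatr_eq0.
have vE : v%:~R = c a * 2 ^+ n :> R.
  by rewrite /c /fourier divfK // hp rmorphB rmorphM.
pose U : int := #|S|%:Z - 2 * q%:Z.
have UE : U%:~R = u :> R by rewrite hq rmorphB rmorphM.
clearbody U v.
apply: (@no_integer_solution n #|S| j U v hk).
- by apply: (@intr_inj R); rewrite rmorphXn /= UE u2.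
- apply: (@intr_inj R); rewrite rmorphM !rmorphB /= UE hj rmorphM /=.
  by rewrite -!pmulrn (cardsD1 a S) aS natrD [_ + _ - 1]addrAC subrr add0r.
(* Here [U * v] represents [f 0 * 2 ^+ n]; squaring removes the unknown sign of [f 0]. *)
- have : (U * v) ^+ 2 = ((2 ^ n)%N%:Z) ^+ 2.
    apply: (@intr_inj R); rewrite !rmorphXn rmorphM /= UE vE mulrA -f0 exprMn f2 mul1r.
    by rewrite -natrX.
  move/eqP; rewrite eqf_sqr => /orP[] /eqP ->;
    by rewrite ?abszN absz_nat.
Qed.
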